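(* For every $p\in(1,\infty)$ there exists a constant $c(p)<\infty$, depending only on $p$, such that for every $Q>1$ and every (arbitrarily small) $\varepsilon>0$ there exists a weight $w$ on $\mathbb{R}$ taking only $2$ values (a.e.), with $Q\le [w]_{A_p}\le c(p)Q$, such that the doubling constants of the weights $w$ and $\sigma=w^{-1/(p-1)}$ are bounded by $2+\varepsilon$.
   Context: A weight on $\mathbb{R}$ is a locally integrable function that is positive a.e. For $1<p<\infty$ the Muckenhoupt characteristic is $$[w]_{A_p}=\sup_I\Big(\frac1{|I|}\int_I w(x)\,dx\Big)\Big(\frac1{|I|}\int_I w(x)^{-1/(p-1)}\,dx\Big)^{p-1},$$ the supremum being over all (bounded) intervals $I\subset\mathbb{R}$. The doubling constant of a weight $w$ is $D_w=\sup_I w(2I)/w(I)$, where the supremum is over all intervals $I$ in $\mathbb{R}$, $2I$ is the interval with the same center as $I$ and length $2|I|$, and $w(I)=\int_I w\,dx$. *)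

(* Defs.v *)
From HB Require Import structures.
From mathcomp Require Import all_boot all_order all_algebra.
From mathcomp Require Import all_classical all_reals all_analysis.

Set Implicit Arguments.
Unset Strict Implicit.
Unset Printing Implicit Defensive.

Import Order.TTheory GRing.Theory Num.Theory.
Import numFieldNormedType.Exports.

Local Open Scope classical_set_scope.
Local Open Scope ring_scope.

Section Weights.
Context {R : realType}.
Implicit Types (w : R -> R) (p a b : R).

Local Notation mu := (@lebesgue_measure R).

Definition weight w : Prop :=
  locally_integrable setT w /\ {ae mu, forall x, 0 < w x}.

Definition dual_weight p w : R -> R := fun x => w x `^ (- (p - 1)^-1).

(* Endpoints do not affect Lebesgue integrals, so bounded intervals of positive
   length are represented by [a, b] with a < b. *)
Definition mass w a b : \bar R := (\int[mu]_(x in `[a, b]) (w x)%:E)%E.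

Definition avg w a b : \bar R := (((b - a)^-1)%:E * mass w a b)%E.

(* Both suprema are extended-real valued: the dual weight need not be locally
   integrable, and the suprema need not be finite. *)
Definition Ap_char p w : \bar R :=
  ereal_sup [set (avg w I.1 I.2 * avg (dual_weight p w) I.1 I.2 `^ (p - 1))%E
            | I in [set I : R * R | I.1 < I.2]].

(* The interval with center m and length 2 * (2 * r) is the concentric double
   of the one with center m and length 2 * r. *)
Definition doubling_const w : \bar R :=
  ereal_sup [set (mass w (J.1 - 2 * J.2) (J.1 + 2 * J.2)
                  / mass w (J.1 - J.2) (J.1 + J.2))%E
            | J in [set J : R * R | 0 < J.2]].

Definition two_valued w : Prop :=
  exists u v : R, [/\ u != v,
    {ae mu, forall x, w x = u \/ w x = v},
    ~ mu.-negligible [set x | w x = u] &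
    ~ mu.-negligible [set x | w x = v]].

End Weights.

(* Main.v *)
(* Take w equal to M := 2^p Q on a set E and to 1 off E.  Then w <= M and
   w^(-1/(p-1)) <= 1, so [w]_{A_p} <= 2^p Q for any E, while an interval in which E
   has density 1/2 gives [w]_{A_p} >= Q.  Both doubling constants are close to 2
   as soon as the densities of E in I and in 2I differ by little for all I.

   Such an E comes from a 4-adic random walk on {0, ..., T} absorbed at 0 and T:
   the four children of a cell in state k have states k, k + 1, k - 1, k, and E is
   the union of the cells absorbed at T.  By self-similarity the density of E in a
   cell is a harmonic function of its state, hence equals k / T.  Adjacent
   cells of one generation have states differing by at most 2, so the density
   of E varies slowly between neighbouring cells when T is large. *)
Require Import Defs.
From HB Require Import structures.
From mathcomp Require Import all_boot all_order all_algebra.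
From mathcomp Require Import zify ring lra.
From mathcomp Require Import all_classical all_reals all_analysis.
From mathcomp Require Import measurable_realfun.

Set Implicit Arguments.
Unset Strict Implicit.
Unset Printing Implicit Defensive.

Import Order.TTheory GRing.Theory Num.Theory.
Import numFieldNormedType.Exports.

Local Open Scope classical_set_scope.
Local Open Scope ring_scope.

(** * The absorbed 4-adic walk and its hitting set *)

Section Walk.
Context {R : realType}.
Variable T : nat.
Implicit Types (k n : nat) (i j m : int) (x : R).

Definition step k i : nat :=
  if (k == 0)%N || (k == T) then k
  else if i == 1 then k.+1 else if i == 2 then k.-1 else k.

(** [j] stands for the interval from [j / 4 ^ n] to [(j + 1) / 4 ^ n], so [j %/ 4] is its parent and
    [j %% 4] its rank among the siblings. All integers [j] are allowed: every unit interval starts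
    in state [k]. *)
Fixpoint cell k n j : nat :=
  if n is n'.+1 then step (cell k n' (j %/ 4)%Z) (j %% 4)%Z else k.

Lemma step_le k i : (k <= T)%N -> (step k i <= T)%N.
Proof.
rewrite /step; case: ifPn => // /norP[k0 kT] kleT.
by case: ifP => _; [lia | case: ifP => _; lia].
Qed.

Lemma step_near k i i' : (step k i <= step k i' + 2)%N.
Proof. by rewrite /step; do ?[case: ifP => _]; lia. Qed.

Lemma cell_le k n j : (k <= T)%N -> (cell k n j <= T)%N.
Proof. by move=> kT; elim: n j => [//|n IH] j /=; exact: step_le. Qed.

(* The first and last steps vanish, so neighbours with different parents inherit
   the parents' states unchanged. *)
Lemma cell_adjacent k n j :
  (cell k n j <= cell k n (j + 1) + 2)%N /\ (cell k n (j + 1) <= cell k n j + 2)%N.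
Proof.
elim: n j => [|n IH] j /=; first by lia.
have [j3|j3] := eqVneq (j %% 4)%Z 3.
  have -> : ((j + 1) %/ 4)%Z = (j %/ 4)%Z + 1 by lia.
  have -> : ((j + 1) %% 4)%Z = 0 by lia.
  rewrite j3; move: (IH (j %/ 4)%Z); rewrite /step /=.
  by rewrite !if_same.
have -> : ((j + 1) %/ 4)%Z = (j %/ 4)%Z by lia.
by split; exact: step_near.
Qed.

Lemma cell_near k n j (r : nat) :
  (cell k n j <= cell k n (j + r%:Z) + 2 * r)%N /\
  (cell k n (j + r%:Z) <= cell k n j + 2 * r)%N.
Proof.
elim: r => [|r [IH1 IH2]]; first by rewrite addr0; lia.
have [] := cell_adjacent k n (j + r%:Z).
have -> : j + r.+1%:Z = j + r%:Z + 1 by lia.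
lia.
Qed.

Definition digit x : int := (Num.floor (4 * x) %% 4)%Z.

(** Reads the base-4 digits of [x] from the first one on, rescaling after each, whereas [cell] peels
    off the last digit; [reach_cell] reconciles the two recursions. *)
Fixpoint walk n k x : nat :=
  if n is n'.+1 then walk n' (step k (digit x)) (4 * x) else k.

Definition reach k : set R := [set x | exists n, walk n k x = T].

Lemma reach_step k x : reach k x <-> reach (step k (digit x)) (4 * x).
Proof.
split=> [[[|n] /= nT]|[n nT]]; last by exists n.+1.
  (* A walk started at [T] has read no digit yet; absorption keeps it at [T] after one more step. *)
  by exists 0%N; rewrite /= /step nT eqxx orbT.
by exists n.
Qed.

Lemma reach0 : (0 < T)%N -> reach 0 = set0.
Proof.
move=> T0; rewrite -subset0 => x [n].
suff -> : walk n 0 x = 0%N by move=> T0'; rewrite -T0' in T0.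
by elim: n x => //= n IH x; rewrite /step eqxx.
Qed.

Lemma reachT : reach T = setT.
Proof. by rewrite -subTset => x _; exists 0%N. Qed.

Lemma floor_shift x m : Num.floor (x + m%:~R) = Num.floor x + m.
Proof. by rewrite floorDrz ?intrKfloor// intr_int. Qed.

(** Shifting [x] by [m] shifts [4 * x] by [4 * m]: the digit is unchanged, and the new shift is
    again an integer, so the induction runs over all [m]. *)
Lemma reach_shift k x m : reach k (x + m%:~R) <-> reach k x.
Proof.
suff H n : forall (m : int) k x, walk n k (x + m%:~R) = walk n k x.
  by split=> -[n nT]; exists n; rewrite -nT H.
elim: n => //= n IH {}m {}k {}x.
have e : 4 * (x + m%:~R) = 4 * x + (4 * m)%:~R :> R by rewrite mulrDr intrM.
rewrite e IH /digit e.
by rewrite floor_shift; congr walk; congr step; lia.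
Qed.

(** Says that the parent of the cell containing a point is the cell of the previous generation
    containing it. *)
Lemma floor_mul4 x : (Num.floor (4 * x) %/ 4)%Z = Num.floor x.
Proof.
apply/esym/floor_def; have /andP[] := floor_itv (4 * x).
move: (Num.floor (4 * x)) => f; set q := (f %/ 4)%Z; set r := (f %% 4)%Z.
have r0 : (0 <= r%:~R :> R) by rewrite ler0z; lia.
have r3 : (r%:~R <= 3 :> R) by rewrite (_ : 3 = 3%:~R)// ler_int; lia.
have fE : f%:~R = 4 * q%:~R + r%:~R :> R.
  by rewrite {1}(divz_eq f 4) -/q -/r [_ * 4]mulrC intrD intrM.
by rewrite !intrD fE => ? ?; apply/andP; split; lra.
Qed.

(** Self-similarity: inside a cell the set is a rescaled copy of the one started from the state of
    that cell. *)
Lemma reach_cell k n x :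
  reach k x <-> reach (cell k n (Num.floor (4 ^+ n * x))) (4 ^+ n * x).
Proof.
elim: n => [|n IH]; first by rewrite expr0 mul1r.
by rewrite IH reach_step exprS -mulrA /= floor_mul4.
Qed.

Lemma measurable_floor_fiber (i : int) :
  measurable [set x : R | Num.floor x = i].
Proof.
rewrite (_ : [set _ | _] = `[i%:~R, (i + 1)%:~R[%classic)//.
apply/seteqP; split => x /=; rewrite in_itv/=; last exact: floor_def.
by move=> <-; exact: floor_itv.
Qed.

Lemma measurable_walk n k c : measurable [set x | walk n k x = c].
Proof.
elim: n k => [|n IH] k /=.
  have [->|kc] := eqVneq k c.
    by rewrite (_ : [set _ | _] = setT)//; apply/seteqP; split.
  by rewrite (_ : [set _ | _] = set0)//; apply/seteqP; split => // x /eqP/=;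
    rewrite (negbTE kc).
(* Splitting by the value of the floor makes the state after one step constant on each of countably
   many pieces. *)
have -> : [set x | walk n (step k (digit x)) (4 * x) = c] =
  \bigcup_(i : int) ([set x | Num.floor (4 * x) = i] `&`
    (fun x => 4 * x) @^-1` [set x | walk n (step k (i %% 4)%Z) x = c]).
  apply/seteqP; split => x /=.
    by move=> H; exists (Num.floor (4 * x)).
  by move=> [i _ [<-]].
apply: countable_bigcupT_measurable => // i.
apply: measurableI; rewrite -[X in measurable X]setTI.
  exact: (mulrl_measurable _ measurableT (measurable_floor_fiber i)).
exact: (mulrl_measurable _ measurableT (IH _)).
Qed.

Lemma measurable_reach k : measurable (reach k).
Proof.
have -> : reach k = \bigcup_n [set x | walk n k x = T].
  by apply/seteqP; split=> x [n]; [exists n|move=> _; exists n].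
by apply: bigcupT_measurable => n; exact: measurable_walk.
Qed.

End Walk.

(** * Length of a set inside a half-open interval *)

Section Length.
Context {R : realType}.
Implicit Types (A : set R) (x y z : R).

Local Notation mu := (@lebesgue_measure R).

(** Half-open intervals match the cells and concatenate disjointly. For measurable [A] the measure
    is finite, so [fine] loses nothing. *)
Definition len A x y : R := fine (mu (A `&` `[x, y[)).

Lemma fin_num_len A x y : measurable A -> mu (A `&` `[x, y[) \is a fin_num.
Proof.
move=> mA; rewrite ge0_fin_numE//.
apply: (@le_lt_trans _ _ (mu `[x, y[%classic)).
  by apply: le_measure; rewrite ?inE//; exact: measurableI.
by rewrite lebesgue_measure_itv/=; case: ifP => _; rewrite ?ltry// -EFinB ltry.
Qed.

Lemma len_ge0 A x y : 0 <= len A x y.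
Proof. exact: fine_ge0. Qed.

Lemma lenT x y : x <= y -> len setT x y = y - x.
Proof.
rewrite /len setTI lebesgue_measure_itv/= lte_fin le_eqVlt.
by move=> /predU1P[->|->//]; rewrite ltxx subrr.
Qed.

Lemma len0 x y : len set0 x y = 0.
Proof. by rewrite /len set0I measure0. Qed.

Lemma len_le A x y : measurable A -> x <= y -> len A x y <= y - x.
Proof.
move=> mA xy; rewrite -lenT//; apply: fine_le; try exact: fin_num_len.
by apply: le_measure; rewrite ?inE//; [exact: measurableI|exact: measurableI|
  exact: setSI].
Qed.

Lemma len_cat A x y z : measurable A -> x <= y -> y <= z ->
  len A x z = len A x y + len A y z.
Proof.
move=> mA xy yz; rewrite /len -fineD; try exact: fin_num_len.
congr fine; rewrite -measureU//; try exact: measurableI.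
  congr (mu _); rewrite -setIUr; congr (_ `&` _).
  apply/seteqP; split => t /=; rewrite !in_itv/=; first by case: (ltP t y); lra.
  by case=> /andP[]; lra.
rewrite -subset0 => t [] [_ /=]; rewrite in_itv/= => /andP[_ ty] [_ /=].
by rewrite in_itv/= leNgt ty.
Qed.

Lemma len_setC A x y : measurable A -> x <= y ->
  len A x y + len (~` A) x y = y - x.
Proof.
move=> mA xy; have mC := measurableC mA; have mI := measurable_itv (`[x, y[).
rewrite -(lenT xy) /len -fineD ?fin_num_len//; congr fine.
rewrite -measureU//; [|exact: measurableI|exact: measurableI|].
  by rewrite -setIUl setUv.
by rewrite -subset0 => t [[At _] [/(_ At)]].
Qed.

Lemma len_neq0 A x y : measurable A -> len A x y != 0 -> ~ mu.-negligible A.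
Proof.
move=> mA /eqP A0 nA; apply: A0; rewrite /len.
suff -> : mu (A `&` `[x, y[) = 0%E by [].
apply/negligibleP; first by apply: measurableI.
by apply: negligibleS nA; exact: subIsetl.
Qed.

(** The scaled pushforward has the right value on the intervals []u, v]], so it is Lebesgue measure
    by uniqueness. *)
Lemma lebesgue_measure_affine (a b : R) A : 0 < a -> measurable A ->
  mu A = (a%:E * mu ((fun x => (a * x + b)%R) @^-1` A))%E.
Proof.
move=> a0 mA; pose f : measurableTypeR R -> measurableTypeR R := fun x => a * x + b.
have mf : measurable_fun [set: measurableTypeR R] f.
  by apply: measurable_funD => //; exact: mulrl_measurable.
suff : mu A = mscale (NngNum (ltW a0)) (pushforward mu f) A
  by move=> /(_ mf) ->.
move=> m; apply: lebesgue_measure_unique => // _ [[u v] _ <-].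
change (mu `]u, v]%classic = (a%:E * mu (f @^-1` `]u, v]%classic))%E).
rewrite (_ : f @^-1` _ = `](u - b) / a, (v - b) / a]%classic); last first.
  apply/seteqP; split => t /=; rewrite !in_itv/= /f;
    by rewrite ltr_pdivrMr// ler_pdivlMr// [t * a]mulrC ltrBlDr lerBrDr.
rewrite !lebesgue_measure_itv/= !lte_fin ltr_pM2r ?invr_gt0// ltrD2r.
case: ifP => _; rewrite ?mule0// -!EFinB -EFinM; congr EFin.
by field; rewrite gt_eqF.
Qed.

Lemma len_affine (a b x y : R) A B : 0 < a -> measurable A ->
  (forall t, x <= t < y -> A t <-> B (a * t + b)) -> measurable B ->
  len A x y = a^-1 * len B (a * x + b) (a * y + b).
Proof.
move=> a0 mA AB mB.
rewrite /len (@lebesgue_measure_affine a b (_ `&` `[a * x + b, _[))//; last first.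
  exact: measurableI.
rewrite (_ : _ @^-1` _ = A `&` `[x, y[%classic).
  by rewrite fineM ?fin_num_len//= mulKf// gt_eqF.
apply/seteqP; split=> t /=; rewrite !in_itv/= lerD2r ltrD2r ler_pM2l// ltr_pM2l//.
  by move=> [Bt txy]; split => //; exact/AB.
by move=> [At txy]; split => //; exact/AB.
Qed.

End Length.

(** * Exact densities in cells *)

Section Harmonic.
Context {R : realType}.
Variable T : nat.
Hypothesis T_gt0 : (0 < T)%N.
Local Notation reach := (@reach R T).

(** The map [t -> 4 ^ n * t - j] carries the cell onto the unit interval; [reach_cell] identifies
    the image of the set, and [reach_shift] absorbs the translation by [j]. *)
Lemma len_reach_cell k n (j : int) :
  len (reach k) (j%:~R / 4 ^+ n) ((j + 1)%:~R / 4 ^+ n) =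
  len (reach (cell T k n j)) 0 1 / 4 ^+ n.
Proof.
have a0 : 0 < 4 ^+ n :> R by rewrite exprn_gt0.
rewrite (@len_affine _ (4 ^+ n) (- j%:~R) _ _ _ (reach (cell T k n j))) //;
  try exact: measurable_reach.
  have e (y : R) : 4 ^+ n * (y / 4 ^+ n) = y by rewrite mulrC divfK ?gt_eqF.
  by rewrite !e subrr intrD addrAC subrr add0r mulrC.
move=> t; rewrite ler_pdivrMr// ltr_pdivlMr// => tj.
rewrite (reach_cell T k n) mulrC (floor_def tj) -intrN.
by split => /reach_shift.
Qed.

(** The quarters of the unit interval have states [k], [k + 1], [k - 1], [k]. With [h] the density,
    [4 h(k) = 2 h(k) + h(k + 1) + h(k - 1)]. *)
Lemma len_reach_harmonic k : (0 < k < T)%N ->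
  2 * len (reach k) 0 1 = len (reach k.-1) 0 1 + len (reach k.+1) 0 1.
Proof.
move=> /andP[k0 kT].
have H (i : int) : len (reach k) (i%:~R / 4) ((i + 1)%:~R / 4) =
    len (reach (step T k (i %% 4)%Z)) 0 1 / 4.
  by have := len_reach_cell k 1 i; rewrite expr1.
have sE i : step T k i = if i == 1 then k.+1 else if i == 2 then k.-1 else k.
  by rewrite /step gtn_eqF// ltn_eqF.
have m := measurable_reach (R := R) T k.
have := H 0; have := H 1; have := H 2; have := H 3; rewrite !sE/= mul0r.
rewrite (_ : 4%:~R / 4 = 1 :> R); last by rewrite divff.
move=> H3 H2 H1 H0.
have := @len_cat R _ 0 (1%:~R / 4) 1 m.
have := @len_cat R _ (1%:~R / 4) (2%:~R / 4) 1 m.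
have := @len_cat R _ (2%:~R / 4) (3%:~R / 4) 1 m.
rewrite H0 H1 H2 H3.
have -> : 1%:~R = 1 :> R by [].
have -> : 2%:~R = 2 :> R by [].
have -> : 3%:~R = 3 :> R by [].
have [a1 a2 a3] : [/\ 0 <= 1 / 4 :> R, 1 / 4 <= 2 / 4 :> R & 2 / 4 <= 3 / 4 :> R].
  by split; lra.
have [b1 b2 b3] : [/\ 1 / 4 <= 1 :> R, 2 / 4 <= 1 :> R & 3 / 4 <= 1 :> R].
  by split; lra.
move=> /(_ a3 b3) C2 /(_ a2 b2) C1 /(_ a1 b1).
rewrite C1 C2 -!mulrDl => C0.
by rewrite mulr_natl; lra.
Qed.

(** A discrete harmonic function on [{0, ..., T}] is affine, and the boundary values are 0 and 1. *)
Lemma len_reach k : (k <= T)%N -> len (reach k) 0 1 = k%:R / T%:R.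
Proof.
pose h k := len (reach k) 0 1 : R.
have h0 : h 0%N = 0 by rewrite /h reach0// len0.
have hT : h T = 1 by rewrite /h reachT lenT// subr0.
(* The recurrence has order two, so the induction carries two consecutive values. *)
have hlin : forall k, (k < T)%N -> h k = k%:R * h 1%N /\ h k.+1 = k.+1%:R * h 1%N.
  elim=> [_|{}k IH kT]; first by rewrite h0 mul0r mul1r.
  have [hk hk1] := IH (ltnW kT); split => //.
  have := @len_reach_harmonic k.+1 kT.
  rewrite -/(h _) -/(h _) -/(h k.+2) hk1 hk -!natr1; lra.
have T0 : T%:R != 0 :> R by rewrite pnatr_eq0 -lt0n.
have hE m : (m <= T)%N -> h m = m%:R * h 1%N.
  by case: m => [|m mT]; [rewrite h0 mul0r|have [] := hlin m mT].
move=> kT; rewrite -/(h k) hE//; congr (_ * _).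
by apply: (mulfI T0); rewrite -hE// hT mulfV.
Qed.

Lemma len_cell k n (j : int) : (k <= T)%N ->
  len (reach k) (j%:~R / 4 ^+ n) ((j + 1)%:~R / 4 ^+ n) =
  (cell T k n j)%:R / T%:R / 4 ^+ n.
Proof. by move=> kT; rewrite len_reach_cell len_reach// cell_le. Qed.

End Harmonic.

(** * Approximate densities in arbitrary intervals *)

Section Density.
Context {R : realType}.
Variables (T k : nat).
Hypotheses (T_gt0 : (0 < T)%N) (kT : (k <= T)%N).
Local Notation reach := (@reach R T).
Local Notation state := (cell T k).
Implicit Types (a b c D r : R) (j : int).

Lemma len_grid n j (m : nat) c D :
  (forall i : nat, (i < m)%N -> `|(state n (j + i%:Z))%:R - c| <= D) ->
  `|len (reach k) (j%:~R / 4 ^+ n) ((j + m%:Z)%:~R / 4 ^+ n) -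
     m%:R / 4 ^+ n * (c / T%:R)| <= m%:R / 4 ^+ n * (D / T%:R).
Proof.
have q0 : 0 < (4 ^+ n)^-1 :> R by rewrite invr_gt0 exprn_gt0.
have T0 : 0 < T%:R^-1 :> R by rewrite invr_gt0 ltr0n.
elim: m => [_|m IH H].
  by rewrite addr0 !mul0r subr0 -[_ / _ in X in len _ X]addr0;
    have := len_le (measurable_reach (R := R) T k) (lexx (j%:~R / 4 ^+ n));
    rewrite subrr addr0 ger0_norm// len_ge0.
have {}IH := IH (fun i im => H i (ltnW im)).
have {}H := H m (ltnSn m).
rewrite (@len_cat _ _ _ ((j + m%:Z)%:~R / 4 ^+ n)) //; first last.
- by rewrite ler_pM2r// ler_int; lia.
- by rewrite ler_pM2r// ler_int; lia.
- exact: measurable_reach.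
have -> : j + m.+1%:Z = (j + m%:Z) + 1 by lia.
rewrite len_cell//.
set s := (state _ _)%:R in H *.
have -> : len (reach k) (j%:~R / 4 ^+ n) ((j + m%:Z)%:~R / 4 ^+ n) +
    s / T%:R / 4 ^+ n - m.+1%:R / 4 ^+ n * (c / T%:R) =
  (len (reach k) (j%:~R / 4 ^+ n) ((j + m%:Z)%:~R / 4 ^+ n) -
    m%:R / 4 ^+ n * (c / T%:R)) + (s - c) * (T%:R^-1 / 4 ^+ n).
  by rewrite -natr1; ring.
apply: (le_trans (ler_normD _ _)).
have -> : m.+1%:R / 4 ^+ n * (D / T%:R) =
   m%:R / 4 ^+ n * (D / T%:R) + D * (T%:R^-1 / 4 ^+ n).
  by rewrite -natr1; ring.
apply: lerD => //; rewrite normrM [X in _ * X <= _]gtr0_norm ?mulr_gt0//.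
by rewrite ler_pM2r// mulr_gt0.
Qed.

(** Both endpoints are rounded down to grid points. Each of the two end pieces costs at most one
    cell length; the grid interval, at most one cell longer than [b - a], is handled by
    [len_grid]. *)
Lemma len_approx n a b c D : a <= b -> 0 <= c <= T%:R -> 0 <= D ->
  (forall j, Num.floor (4 ^+ n * a) <= j <= Num.floor (4 ^+ n * b) ->
     `|(state n j)%:R - c| <= D) ->
  `|len (reach k) a b - (b - a) * (c / T%:R)| <=
    2 / 4 ^+ n + (b - a + (4 ^+ n)^-1) * (D / T%:R).
Proof.
move=> ab /andP[c0 cT] D0 H; have q0 : 0 < 4 ^+ n :> R by rewrite exprn_gt0.
have T0 : 0 < T%:R :> R by rewrite ltr0n.
have cT0 : 0 <= c / T%:R by rewrite divr_ge0// ltW.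
have cT1 : c / T%:R <= 1 by rewrite ler_pdivrMr// mul1r.
have mr := measurable_reach (R := R) T k.
move: H; have := floor_itv (4 ^+ n * a); have := floor_itv (4 ^+ n * b).
have := le_floor (ler_wpM2l (ltW q0) ab).
move: (Num.floor (_ * b)) (Num.floor (_ * a)) => jb ja jab.
rewrite !intrD => /andP[jb0 jb1] /andP[ja0 ja1] H.
have [m jE] : exists m : nat, jb = ja + m%:Z.
  by exists `|jb - ja|%N; rewrite gez0_abs ?subr_ge0// subrKC.
have := @len_grid n ja m c D.
rewrite -jE => /(_ _)/wrap[i im|].
  by apply: H; rewrite lerDl jE lerD2l [(i%:Z <= _)%R]lez_nat (ltnW im) andbT lez_nat.
pose A : R := ja%:~R / 4 ^+ n; pose B : R := jb%:~R / 4 ^+ n.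
have -> : m%:R / 4 ^+ n = B - A by rewrite -mulrBl jE intrD addrC addKr.
rewrite -/A -/B.
have AB : A <= B by rewrite ler_pM2r ?invr_gt0// ler_int.
have Aa : A <= a by rewrite ler_pdivrMr// mulrC.
have Bb : B <= b by rewrite ler_pdivrMr// mulrC.
have Aa1 : a - A <= (4 ^+ n)^-1.
  by rewrite lerBlDl -(mul1r (_ ^-1)) -mulrDl ler_pdivlMr// mulrC ltW.
have Bb1 : b - B <= (4 ^+ n)^-1.
  by rewrite lerBlDl -(mul1r (_ ^-1)) -mulrDl ler_pdivlMr// mulrC ltW.
have := len_cat mr Aa ab; have := len_cat mr AB Bb.
have := len_le mr Aa; have := len_le mr Bb.
have := len_ge0 (reach k) A a; have := len_ge0 (reach k) B b.
move: (len _ A a) (len _ B b) (len _ a b) (len _ A b) (len _ A B).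
have : 0 <= D / T%:R by rewrite divr_ge0// ltW.
move: (D / T%:R) (c / T%:R) cT0 cT1 => d t t0 t1 d0.
move: (_^-1) Aa1 Bb1 => e Aa1 Bb1 u v x y z u0 v0 ub vb -> xE.
have BA : B - A <= b - a + e by lra.
have := ler_wpM2r d0 BA.
have : (a - A) * t <= a - A by rewrite ler_piMr// subr_ge0.
have : 0 <= (a - A) * t by rewrite mulr_ge0// subr_ge0.
have : (b - B) * t <= b - B by rewrite ler_piMr// subr_ge0.
have : 0 <= (b - B) * t by rewrite mulr_ge0// subr_ge0.
by rewrite !ler_norml => ? ? ? ? ? /andP[? ?]; apply/andP; split; lra.
Qed.

End Density.

(** Take the least [n] that works. If [n] is positive, minimality bounds [r] by fewer than [4 * K]
    cells; if [n = 0], [r] may be arbitrarily large. *)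
Lemma scale_exists (R : realType) (K r : R) : 0 < r ->
  exists n, K <= 4 ^+ n * r /\ (n = 0%N \/ 4 ^+ n * r < 4 * K).
Proof.
move=> r0; have ex : exists n, K <= 4 ^+ n * r.
  exists (Num.truncn (K / r)).+1; rewrite -ler_pdivrMr//.
  apply/ltW/(lt_le_trans (truncnS_gt _)).
  by rewrite -natrX ler_nat ltnW// ltn_expl.
have [] := ex_minnP ex => -[|n] Kn nmin; first by exists 0%N; split => //; left.
exists n.+1; split => //; right; rewrite exprS -mulrA ltr_pM2l// ltNge.
by apply/negP => /nmin; rewrite ltnn.
Qed.

(* Covering an interval and its double by about [K] cells of the walk, the
   states vary by [O(K)] out of [T], and the cells cut by the endpoints contribute
   a proportion [O(1/K)]; hence [1 << K << T]. *)
Lemma slowly_varying_density (R : realType) (delta : R) : 0 < delta ->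
  exists E : set R, [/\ measurable E, len E 0 1 = 2^-1 &
    forall m r, 0 < r ->
      `|len E (m - 2 * r) (m + 2 * r) - 2 * len E (m - r) (m + r)| <= delta * r].
Proof.
(* With [e] the cell length and [d = 34 * K / T], the total error is at most
   [6 * e + 8 * r * d + 3 * e * d]. Since [e <= r / K], this [K] makes the first term at most
   [delta * r / 2]. *)
move=> d0; pose K := 12 / delta + 1.
have K1 : 1 <= K by rewrite lerDr divr_ge0// ltW.
(* Here [748 = 22 * 34] gives [d <= delta / 22], and as [e <= r] the other two terms are at most
   [11 * r * d], again half of [delta * r]. Starting at [N], halfway to [T], gives density 1/2. *)
pose N := (Num.truncn (748 * K / delta)).+1; pose T := N.*2.
have T0 : (0 < T)%N by rewrite /T double_gt0.
have NT : (N <= T)%N by rewrite /T -addnn leq_addr.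
have KT : 748 * K / delta <= T%:R.
  by apply/ltW/(lt_le_trans (truncnS_gt _)); rewrite ler_nat.
exists (reach T N); split; first exact: measurable_reach.
  rewrite len_reach// /T -muln2 natrM invfM mulrA divff ?mul1r//.
  by rewrite pnatr_eq0.
move=> m r r0; have [n [Kn nK]] := scale_exists K r0.
set q := 4 ^+ n in Kn nK; have q0 : 0 < q by rewrite exprn_gt0.
pose j0 := Num.floor (q * (m - 2 * r)).
pose c : R := (cell T N n j0)%:R.
have c0T : 0 <= c <= T%:R by rewrite ler0n ler_nat cell_le.
(* The doubled interval spans less than [16 * K] cell lengths, so indices differ by at most
   [16 * K + 1]; each index step moves the state by at most 2, and [32 * K + 2 <= 34 * K]. *)
have close j : j0 <= j <= Num.floor (q * (m + 2 * r)) ->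
    `|(cell T N n j)%:R - c| <= 34 * K.
  case/andP => j0j jb; have [i jE] : exists i : nat, j = j0 + i%:Z.
    by exists `|j - j0|%N; rewrite gez0_abs ?subr_ge0// subrKC.
  (* At generation 0 every cell has state [N], so large intervals show no variation. *)
  case: nK => [n0|nK].
    by rewrite /c n0/= subrr normr0; lra.
  have iK : (i%:R : R) <= 16 * K + 1.
    have -> : (i%:R : R) = j%:~R - j0%:~R by rewrite jE intrD addrC addKr.
    have : (j%:~R : R) <= q * (m + 2 * r).
      by apply: le_trans (floor_le _); rewrite ler_int.
    have /andP[_] := floor_itv (q * (m - 2 * r)); rewrite -/j0 intrD.
    lra.
  have := cell_near T N n j0 i; rewrite -jE -!(ler_nat R) 2!natrD natrM -/c.
  by case=> h1 h2; rewrite ler_norml; apply/andP; split; lra.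
have D0 : 0 <= 34 * K by lra.
have q1 : q^-1 <= r / K.
  by rewrite ler_pdivlMr ?(lt_le_trans _ K1)// mulrC ler_pdivrMr// mulrC.
have dT : 34 * K / T%:R <= delta / 22.
  rewrite ler_pdivrMr ?ltr0n//; move: KT; rewrite ler_pdivrMr//; lra.
have dK : r / K <= r * delta / 12.
  rewrite ler_pdivrMr ?(lt_le_trans _ K1)// /K mulrDr mulr1.
  have -> : r * delta / 12 * (12 / delta) = r by field; rewrite gt_eqF.
  by rewrite lerDl; apply: divr_ge0 => //; apply: mulr_ge0; exact: ltW.
have dK1 : r / K <= r by rewrite ler_pdivrMr ?(lt_le_trans _ K1)// ler_peMr// ltW.
(* The same [c] serves for both intervals, so the main terms [4 * r * (c / T)] and
   [2 * (2 * r * (c / T))] cancel. *)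
have := @len_approx R T N T0 NT n (m - 2 * r) (m + 2 * r) c _ _ c0T D0 close.
have := @len_approx R T N T0 NT n (m - r) (m + r) c _ _ c0T D0.
rewrite -/q => /(_ _ _)/wrap[|j /andP[ja jb]|]; first by lra.
  apply: close; rewrite (le_trans _ ja)/= ?(le_trans jb)//.
    by apply/le_floor/ler_wpM2l; [exact: ltW|lra].
  by apply/le_floor/ler_wpM2l; [exact: ltW|lra].
move=> H1 /(_ _)/wrap[|H2]; first by lra.
have dT0 : 0 <= 34 * K / T%:R by rewrite divr_ge0.
set d := 34 * K / _ in dT dT0 H1 H2.
have e0 : 0 <= q^-1 by rewrite invr_ge0 ltW.
move: (len _ _ _) (len _ _ _) (c / _) (q^-1) q1 e0 H1 H2 => x y t e q1 e0 H1 H2.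
have rd : r * d <= r * (delta / 22) by rewrite ler_wpM2l// ltW.
have ed : e * d <= r * d by rewrite ler_wpM2r// (le_trans q1).
move: H1 H2; rewrite !ler_norml => /andP[? ?] /andP[? ?].
by apply/andP; split; lra.
Qed.

(** * Weights with two values *)

Section StepWeight.
Context {R : realType}.
Local Notation mu := (@lebesgue_measure R).
Implicit Types (E : set R) (u v a b : R).

Definition step_weight E u v : R -> R := fun x => if x \in E then u else v.

Lemma dual_step_weight p E u v : dual_weight p (step_weight E u v) =
  step_weight E (u `^ (- (p - 1)^-1)) (v `^ (- (p - 1)^-1)).
Proof. by apply/funext => x; rewrite /dual_weight /step_weight; case: ifP. Qed.

Lemma measurable_step_weight E u v (D : set R) :
  measurable E -> measurable_fun D (step_weight E u v).
Proof.
move=> mE; apply: (@measurable_funS _ _ _ _ setT) => //.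
rewrite (_ : step_weight E u v = fun x => (u - v) * \1_E x + v).
  by apply: measurable_funD => //; apply: measurable_funM.
by apply/funext => x; rewrite /step_weight indicE; case: (x \in E) => /=; lra.
Qed.

Lemma mass_step_weight E u v a b : measurable E -> 0 <= u -> 0 <= v -> a <= b ->
  mass (step_weight E u v) a b = (u * len E a b + v * (b - a - len E a b))%:E.
Proof.
move=> mE u0 v0 ab; rewrite /mass -integral_itv_bndo_bndc; last first.
  by apply/measurable_EFinP; exact: measurable_step_weight.
pose I := `[a, b[%classic : set R.
have mI : measurable I by exact: measurable_itv.
rewrite -/I (_ : I = (E `&` I) `|` (~` E `&` I)); last first.
  by rewrite -setIUl setUv setTI.
have mEC : measurable (~` E) by exact: measurableC.
rewrite ge0_integral_setU//; first last.
- apply/disj_setPS => x [[Ex _] [/(_ Ex)]] //.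
- by move=> x _; rewrite lee_fin /step_weight; case: ifP.
- by apply/measurable_EFinP; exact: measurable_step_weight.
- exact: measurableI.
- exact: measurableI.
rewrite (eq_integral (cst u%:E)); last first.
  by move=> x /set_mem[Ex _]; rewrite /step_weight mem_set.
rewrite [X in (_ + X)%E](eq_integral (cst v%:E)); last first.
  by move=> x /set_mem[Ex _]; rewrite /step_weight memNset.
rewrite !integral_cst//; try exact: measurableI.
have lE A : measurable A -> mu (A `&` I) = (len A a b)%:E.
  by move=> mA; rewrite fineK// fin_num_len.
transitivity (u%:E * (len E a b)%:E + v%:E * (len (~` E) a b)%:E)%E.
  by congr (_ * _ + _ * _)%E; exact: lE.
rewrite -!EFinM -EFinD; congr (_ + _ * _)%:E.
by rewrite -(len_setC mE ab) addrC addKr.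
Qed.

Lemma avg_step_weight E u v a b : measurable E -> 0 <= u -> 0 <= v -> a < b ->
  avg (step_weight E u v) a b =
    ((b - a)^-1 * (u * len E a b + v * (b - a - len E a b)))%:E.
Proof. by move=> mE u0 v0 ab; rewrite /avg mass_step_weight// ltW. Qed.

Lemma weight_step_weight E u v : measurable E -> 0 < u -> 0 < v ->
  weight (step_weight E u v).
Proof.
move=> mE u0 v0; split; last first.
  by apply: aeW => x; rewrite /step_weight; case: ifP.
split; [exact: measurable_step_weight|exact: openT|move=> K _ cK].
have mK := compact_measurable cK.
apply: (@le_lt_trans _ _ (\int[mu]_(x in K) cst (u + v)%:E x)%E).
  apply: ge0_le_integral => //=.
    by do 2 apply: measurableT_comp => //; exact: measurable_step_weight.
  move=> x _; rewrite lee_fin /step_weight.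
  by case: ifP => _; rewrite gtr0_norm ?lerDl ?lerDr// ltW.
by rewrite integral_cst// lte_mul_pinfty ?lee_fin ?addr_ge0 ?ltW ?compact_finite_measure.
Qed.

(** The mass of the double minus twice the mass of the interval is [(u - v) * (G - 2 * g)], with [G]
    and [g] the lengths of [E] in them. It is at most [eps] times the mass, which is at least
    [2 * r] times the smaller of [u] and [v]. *)
Lemma doubling_step_weight E u v (delta eps : R) : measurable E -> 0 < u -> 0 < v ->
  (forall m r : R, 0 < r ->
    `|len E (m - 2 * r) (m + 2 * r) - 2 * len E (m - r) (m + r)| <= delta * r) ->
  `|u - v| * delta <= 2 * eps * u -> `|u - v| * delta <= 2 * eps * v ->
  (doubling_const (step_weight E u v) <= (2 + eps)%:E)%E.
Proof.
move=> mE u0 v0 H du dv; apply: ge_ereal_sup => _ [[m r] /= r0 <-].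
have I1 : m - r <= m + r by lra.
have I2 : m - 2 * r <= m + 2 * r by lra.
rewrite (mass_step_weight mE (ltW u0) (ltW v0) I1).
rewrite (mass_step_weight mE (ltW u0) (ltW v0) I2).
have := H m r r0; have lg0 := len_ge0 E (m - r) (m + r).
have lg1 : len E (m - r) (m + r) <= m + r - (m - r) by exact: len_le.
move: (len E (m - r) _) (len E (m - 2 * r) _) lg0 lg1 => g G g0 g1 {}H.
have ug : 0 <= u * g by rewrite mulr_ge0// ltW.
have vg : 0 <= v * (m + r - (m - r) - g) by rewrite mulr_ge0 ?(ltW v0)// subr_ge0.
have pos : 0 < u * g + v * (m + r - (m - r) - g).
  have [gp|gn] := ltP 0 g; first by rewrite ltr_wpDr// mulr_gt0.
  by rewrite ltr_wpDl// mulr_gt0//; lra.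
rewrite inver gt_eqF// -EFinM lee_fin ler_pdivrMr//.
have uvG : (u - v) * (G - 2 * g) <= `|u - v| * (delta * r).
  by apply: (le_trans (ler_norm _)); rewrite normrM ler_wpM2l.
(* The length [2 * r] is split into the parts in [E] and off [E]; the two bounds add up to [2 * eps]
   times the mass. *)
have k1 : `|u - v| * delta * g <= 2 * eps * u * g by rewrite ler_wpM2r.
have k2 : `|u - v| * delta * (2 * r - g) <= 2 * eps * v * (2 * r - g).
  by rewrite ler_wpM2r//; lra.
by move: `|_| uvG k1 k2 => s uvG k1 k2; lra.
Qed.

End StepWeight.

(** * Choice of the values and verification of the bounds *)

Theorem proposition1p5 (R : realType) (p : R) (hp : 1 < p) :
  exists c : R, forall Q eps : R, 1 < Q -> 0 < eps ->
    exists w : R -> R,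
      [/\ weight w /\ weight (dual_weight p w),
          two_valued w,
          (Q%:E <= Ap_char p w)%E /\ (Ap_char p w <= (c * Q)%:E)%E,
          (doubling_const w <= (2 + eps)%:E)%E &
          (doubling_const (dual_weight p w) <= (2 + eps)%:E)%E].
Proof.
have p1 : 0 < p - 1 by rewrite subr_gt0.
exists (2 `^ p) => Q eps Q1 eps0.
pose M := 2 `^ p * Q; pose s := M `^ (- (p - 1)^-1).
have c1 : 1 <= 2 `^ p.
  by rewrite -[leLHS](powRr0 2) ler_powR ?ler1n// ?ltW// (lt_trans _ hp).
have M1 : 1 < M by rewrite (lt_le_trans Q1)// ler_peMl// ltW// (lt_trans _ Q1).
have M0 : 0 < M by rewrite (lt_trans _ M1).
have s0 : 0 < s by rewrite powR_gt0.
have s1 : s <= 1.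
  by rewrite -[leRHS](powRr0 M) ler_powR ?oppr_le0 ?invr_ge0 ?ltW.
(* This [delta] serves both weights: the gaps [M - 1] and [1 - s] are at most [M], and [s] is the
   smallest of the values [M], [1], [s]. *)
have delta0 : 0 < 2 * eps * s / M by rewrite divr_gt0// !mulr_gt0.
have [E [mE E1 HE]] := slowly_varying_density delta0.
have sE : dual_weight p (step_weight E M 1) = step_weight E s 1.
  by rewrite dual_step_weight powR1.
exists (step_weight E M 1); rewrite /Ap_char sE.
have es0 : 0 < eps * s by rewrite mulr_gt0.
split.
- by split; exact: weight_step_weight.
- exists M, 1; split; first by rewrite gt_eqF.
  + by apply: aeW => x; rewrite /step_weight; case: ifP; [left|right].
  + rewrite (_ : [set _ | _] = E); last first.
      apply/seteqP; split=> x; rewrite /= /step_weight.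
        by case: ifPn => [/set_mem//|_ /eqP]; rewrite lt_eqF.
      by move=> Ex; rewrite mem_set.
    by apply: (@len_neq0 _ _ 0 1) => //; rewrite E1 invr_eq0 pnatr_eq0.
  + rewrite (_ : [set _ | _] = ~` E); last first.
      apply/seteqP; split=> x; rewrite /= /step_weight.
        by case: ifPn => [_ /eqP|/negP xE _ /mem_set//]; rewrite gt_eqF.
      by move=> Ex; rewrite memNset.
    apply: (@len_neq0 _ _ 0 1); first exact: measurableC.
    have := len_setC mE ler01; rewrite E1 => H.
    by apply/eqP => H0; move: H; rewrite H0; lra.
- have W0 : 0 <= M by exact: ltW.
  have S0 : 0 <= s by exact: ltW.
  split.
    (* On the unit interval, keeping only [E] for the weight and only its complement for the dual
       gives averages at least [M / 2] and [1 / 2]; the factor [2 ^ p] in [M] makes the resulting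
       product equal to [Q]. *)
    apply: le_trans (ereal_sup_ubound _); last first.
      by exists (0, 1) => //=; exact: ltr01.
    rewrite /= !avg_step_weight// poweR_EFin -EFinM lee_fin E1 subr0 invr1 !mul1r.
    have -> : Q = M / 2 * (2^-1) `^ (p - 1).
      rewrite -mulrA -[X in _ = M * (X * _)](@powRr1 _ 2^-1)//.
      rewrite -powRD; last by rewrite addrC subrK gt_eqF// (lt_trans _ hp).
      by rewrite addrC subrK -powR_inv1// -powRrM mulN1r powRN /M mulrAC mulfV ?mul1r.
    apply: ler_pM; rewrite ?powR_ge0 ?divr_ge0//; first by lra.
    apply: ge0_ler_powR; rewrite ?nnegrE; [exact: ltW|by []| |]; lra.
  apply: ge_ereal_sup => _ [[a b] /= ab <-].
  rewrite !avg_step_weight// poweR_EFin -EFinM lee_fin -/M -[leRHS]mulr1.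
  have ba : 0 < b - a by rewrite subr_gt0.
  have L0 := len_ge0 E a b; have L1 := len_le mE (ltW ab).
  have Z0 : 0 <= b - a - len E a b by rewrite subr_ge0.
  have Y0 : 0 <= s * len E a b + 1 * (b - a - len E a b).
    by rewrite mul1r addr_ge0 ?mulr_ge0.
  have Y1 : (b - a)^-1 * (s * len E a b + 1 * (b - a - len E a b)) <= 1.
    rewrite mulrC ler_pdivrMr//.
    by have := ler_wpM2r L0 s1; lra.
  have X1 : (b - a)^-1 * (M * len E a b + 1 * (b - a - len E a b)) <= M.
    rewrite mulrC ler_pdivrMr//.
    have : 1 * (b - a - len E a b) <= M * (b - a - len E a b).
      by rewrite ler_wpM2r ?(ltW M1).
    by lra.
  have i0 : 0 <= (b - a)^-1 by rewrite invr_ge0 ltW.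
  apply: ler_pM => //; [|exact: powR_ge0|].
    by apply: mulr_ge0 => //; rewrite mul1r; apply: addr_ge0 => //; exact: mulr_ge0.
  rewrite -[leRHS](_ : 1 `^ (p - 1) = 1); last by rewrite powR1.
  apply: ge0_ler_powR; rewrite ?nnegrE//.
    exact: ltW.
  exact: mulr_ge0.
- have D : `|M - 1| * (2 * eps * s / M) <= 2 * eps * s.
    rewrite ger0_norm ?subr_ge0 ?(ltW M1)// mulrA ler_pdivrMr//.
    by rewrite mulrC ler_pM2l ?mulr_gt0//; lra.
  have es : eps * s <= eps by rewrite ler_piMr// ltW.
  have eM : eps <= eps * M by rewrite ler_peMr// ltW.
  by apply: doubling_step_weight HE _ _ => //; lra.
- have D : `|s - 1| * (2 * eps * s / M) <= 2 * eps * s.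
    rewrite ler0_norm ?subr_le0// mulrA ler_pdivrMr// mulrC ler_pM2l ?mulr_gt0//.
    lra.
  have es : eps * s <= eps by rewrite ler_piMr// ltW.
  by apply: doubling_step_weight HE _ _ => //; lra.
Qed.
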